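(* Let $(W,S)$ be a finite Coxeter system. Let $v,w\in W$ be such that $v\leq w$. Let $\beta\in\Delta$ be such that $v<s_\beta v$. Let $v'=s_\beta v$, $w'=s_\beta w$, $\alpha=v^{-1}(\beta)$. Then \[ \partial_{w/v}=\begin{cases}\partial_\alpha\partial_{w/v'} & \text{if } w>w',\\ \partial_\alpha\partial_{w/v'}+\partial_{w'/v'} & \text{if } w<w'.\end{cases} \]
   Context: Coxeter setup. $(W,S)$ is a Coxeter system with $W$ finite; $m(s,s')$ is the order of $ss'$. $\mathfrak h_{\mathbb R}$ is a real vector space with basis $\Delta$ (the simple roots), in bijection with $S$ via $\beta\mapsto s_\beta$, with symmetric bilinear form $B(\beta,\beta')=-\cos(\pi/m(s_\beta,s_{\beta'}))$. $W$ acts by $s_\beta(x)=x-2B(x,\beta)\beta$, and $B$ is a $W$-invariant scalar product. $R=\{u(\beta):u\in W,\beta\in\Delta\}$ is the root system. For $\alpha=u(\beta)\in R$, $s_\alpha=us_\beta u^{-1}$. $\leq$ (strictly: $<$) is the (strong) Bruhat order. Products $\prod_{j\in J}$ over a finite set $J$ of integers are taken in increasing order of the index (empty product $=1$). Coinvariant algebra and operators. $\mathfrak h=\mathfrak h_{\mathbb R}\otimes\mathbb C$, $S(\mathfrak h)$ is the symmetric algebra with its $W$-action, $I_W$ the ideal generated by the $W$-invariant polynomials without constant term, and $S_W=S(\mathfrak h)/I_W$. For $\alpha\in R$, $\partial_\alpha=\frac{1-s_\alpha}{\alpha}$ is the $\mathbb C$-linear endomorphism of $S_W$ induced by $f\mapsto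 (f-s_\alpha f)/\alpha$ on $S(\mathfrak h)$. Skew divided difference operators: for $v\leq w$, fix a reduced expression $s_{\gamma_1}\cdots s_{\gamma_k}$ of $w$; for $J\subseteq\{1,\ldots,k\}$ let $\partial_J=\delta_1\cdots\delta_k$, where $\delta_j=s_{\gamma_j}$ (acting on $S_W$) if $j\in J$ and $\delta_j=\partial_{\gamma_j}$ if $j\notin J$; then $\partial_{w/v}=v^{-1}\sum_J\partial_J$, the sum over all $J$ such that $\prod_{j\in J}s_{\gamma_j}$ is a reduced expression of $v$ (independent of the reduced expression of $w$). For $v\not\leq w$, $\partial_{w/v}=0$. *)

(* Defs.v *)
From HB Require Import structures.
From mathcomp Require Import all_boot all_order all_algebra all_fingroup.
From mathcomp Require Import generic_quotient boolp classical_sets reals trigo.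
From mathcomp Require Import complex mpoly.
From mathcomp Require Import ring.

Set Implicit Arguments.
Unset Strict Implicit.
Unset Printing Implicit Defensive.

Import Order.TTheory GRing.Theory Num.Theory.

Local Open Scope ring_scope.

(* A Coxeter system (W, S) with W finite; the generating set S is indexed      *)
(* injectively by 'I_rank, which also indexes the simple roots. The last       *)
(* field is the universal property of the presentation                         *)
(* W = < S | (s s')^m(s,s') = 1 >, where m(s,s') = #[s * s'].                  *)
Record coxeterSystem := CoxeterSystem {
  cox_group :> finGroupType;
  rank : nat;
  gen : 'I_rank -> cox_group;
  gen_inj : injective gen;
  gen_order : forall i, #[gen i]%g = 2%N;
  gen_generates : <<[set gen i | i : 'I_rank]>>%g = [set: cox_group];
  gen_presentation : forall (H : groupType) (f : 'I_rank -> H),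
    (forall i j, ((f i * f j) ^+ #[gen i * gen j])%g = 1%g) ->
    exists phi : cox_group -> H,
      {morph phi : x y / (x * y)%g} /\ (forall i, phi (gen i) = f i)
}.

Section Words.
Variable W : coxeterSystem.

Definition wprod (a : seq 'I_(rank W)) : W := (\prod_(i <- a) gen i)%g.

Lemma genV (i : 'I_(rank W)) : ((gen i)^-1 = gen i)%g.
Proof.
apply/eqP; rewrite eq_invg_mul.
by have := expg_order (gen i); rewrite gen_order expgS expg1 => ->.
Qed.

Lemma wprod_cons i a : wprod (i :: a) = (gen i * wprod a)%g.
Proof. by rewrite /wprod big_cons. Qed.

Lemma word_exists (w : W) :
  exists k, [exists t : k.-tuple 'I_(rank W), wprod t == w].
Proof.
have: w \in <<[set gen i | i : 'I_(rank W)]>>%g by rewrite gen_generates inE.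
case/gen_prodgP=> k [c cS ->]; exists k; apply/existsP.
have cP j : exists i, c j == gen i.
  by case/imsetP: (cS j) => i _ ->; exists i.
exists [tuple xchoose (cP j) | j < k]; apply/eqP.
rewrite /wprod big_tuple; apply: eq_bigr => j _.
by rewrite tnth_mktuple -(eqP (xchooseP (cP j))).
Qed.

Definition len (w : W) : nat := ex_minn (word_exists w).

Definition reduced_expr (a : seq 'I_(rank W)) (w : W) : bool :=
  (wprod a == w) && (size a == len w).

Lemma reduced_expr_exists (w : W) : exists a, reduced_expr a w.
Proof.
rewrite /reduced_expr /len; case: ex_minnP => k /existsP[t /eqP tw] _.
by exists t; rewrite tw size_tuple !eqxx.
Qed.

Definition red_expr (w : W) : seq 'I_(rank W) := xchoose (reduced_expr_exists w).

Lemma red_exprP w : reduced_expr (red_expr w) w.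
Proof. exact: (xchooseP (reduced_expr_exists w)). Qed.

Lemma wprod_red_expr w : wprod (red_expr w) = w.
Proof. by have /andP[/eqP] := red_exprP w. Qed.

Definition is_reflection (t : W) : bool :=
  [exists u : W, exists i, t == (u * gen i * u^-1)%g].

Definition bruhat_step (x y : W) : bool :=
  [exists t : W, [&& is_reflection t, y == (t * x)%g & (len x < len y)%N]].

Definition bruhat_le : rel W := connect bruhat_step.

Definition bruhat_lt (x y : W) : bool := (x != y) && bruhat_le x y.

End Words.

Section Geometry.
Variables (R : realType) (W : coxeterSystem).
Local Notation n := (rank W).
Local Notation h := 'rV[R]_n.
Implicit Types (x y : h) (u v w : W).

Definition simple (i : 'I_n) : h := delta_mx 0 i.

Definition cox_mx : 'M[R]_n :=
  \matrix_(i, j) - cos (pi / #[gen i * gen j]%g%:R).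

Definition formB x y : R := (x *m cox_mx *m y^T) 0 0.

Definition simple_refl (i : 'I_n) x : h :=
  x - (2 * formB x (simple i)) *: simple i.

(* The action of W on h_R. That it is an action, and that the chosen reduced   *)
(* expression of w is immaterial, is geom_gen and geomM below.                 *)
Definition geom w x : h := foldr simple_refl x (red_expr w).

End Geometry.

Arguments simple {R W} i.

Section GeneralLinear.
Variables (K : comUnitRingType) (n : nat).

(* Invertible matrices acting on row vectors, with the opposite product, so    *)
(* that they act on the left.                                                  *)
Definition glmx := {A : 'M[K]_n | A \in unitmx}.
HB.instance Definition _ := Choice.on glmx.

Let one : glmx := Sub 1%:M (unitmx1 K n).
Let inv (A : glmx) : glmx := Sub (invmx (val A)) (etrans (unitmx_inv _) (valP A)).
Local Lemma mul_subproof (A B : glmx) : val B *m val A \in unitmx.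
Proof. by rewrite unitmx_mul; apply/andP; split; apply: valP. Qed.
Let mul (A B : glmx) : glmx := Sub (val B *m val A) (mul_subproof A B).

Local Lemma glmx_mulA : associative mul.
Proof. by move=> A B C; apply: val_inj; rewrite /= mulmxA. Qed.
Local Lemma glmx_mul1 : left_id one mul.
Proof. by move=> A; apply: val_inj; rewrite /= mulmx1. Qed.
Local Lemma glmx_mulr1 : right_id one mul.
Proof. by move=> A; apply: val_inj; rewrite /= mul1mx. Qed.
Local Lemma glmx_mulV : left_inverse one inv mul.
Proof. by move=> A; apply: val_inj; exact: mulmxV (valP A). Qed.
Local Lemma glmx_mulrV : right_inverse one inv mul.
Proof. by move=> A; apply: val_inj; exact: mulVmx (valP A). Qed.

HB.instance Definition _ := isGroup.Build glmx
  glmx_mulA glmx_mul1 glmx_mulr1 glmx_mulV glmx_mulrV.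

Lemma val_glmxM (A B : glmx) : val (A * B)%g = val B *m val A.
Proof. by []. Qed.

Lemma val_glmx1 : val (1%g : glmx) = 1%:M.
Proof. by []. Qed.

End GeneralLinear.

Section GeometryTheory.
Variables (R : realType) (W : coxeterSystem).
Local Notation n := (rank W).
Local Notation h := 'rV[R]_n.
Implicit Types (x y : h) (u v w : W).

Lemma formBDl x y z : formB (x + y) z = formB x z + formB y z.
Proof. by rewrite /formB !mulmxDl mxE. Qed.

Lemma formBZl a x y : formB (a *: x) y = a * formB x y.
Proof. by rewrite /formB -!scalemxAl mxE. Qed.

Lemma cox_mx_sym : (cox_mx R W)^T = cox_mx R W.
Proof.
apply/matrixP=> i j; rewrite !mxE; congr (- cos (pi / _%:R)).
by rewrite -[in RHS]orderV invMg !genV.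
Qed.

Lemma formBC x y : formB x y = formB y x.
Proof.
rewrite /formB -[in RHS](trmxK (y *m _ *m _)) [in RHS]mxE.
by rewrite !trmx_mul trmxK cox_mx_sym mulmxA.
Qed.

Lemma formBDr x y z : formB x (y + z) = formB x y + formB x z.
Proof. by rewrite formBC formBDl !(formBC _ x). Qed.

Lemma formBZr a x y : formB x (a *: y) = a * formB x y.
Proof. by rewrite formBC formBZl formBC. Qed.

Lemma formB_simple (i j : 'I_n) :
  formB (simple i) (simple j) = - cos (pi / #[gen i * gen j]%g%:R) :> R.
Proof. by rewrite /formB trmx_delta -rowE -colE !mxE. Qed.

Lemma formB_simple1 (i : 'I_n) : formB (simple i) (simple i) = 1 :> R.
Proof.
by rewrite formB_simple -{1}genV mulVg order1 divr1 cospi opprK.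
Qed.

Lemma simple_reflD i x y :
  simple_refl i (x + y) = simple_refl i x + simple_refl i y.
Proof.
by rewrite /simple_refl formBDl mulrDr scalerDl opprD addrACA.
Qed.

Lemma simple_reflZ i a x : simple_refl i (a *: x) = a *: simple_refl i x.
Proof.
by rewrite /simple_refl formBZl scalerBr scalerA mulrCA.
Qed.

Lemma simple_refl_isometry i x y :
  formB (simple_refl i x) (simple_refl i y) = formB x y.
Proof.
rewrite /simple_refl -!scaleNr !(formBDl, formBDr, formBZl, formBZr).
rewrite formB_simple1 (formBC (simple i) y); ring.
Qed.

Lemma simple_reflK i : involutive (simple_refl (R := R) (W := W) i).
Proof.
move=> x; rewrite /simple_refl -!scaleNr !(formBDl, formBZl) formB_simple1.
by rewrite -addrA -scalerDl -[RHS]addr0; congr (_ + _); rewrite -[RHS](scale0r (simple i)); congr (_ *: _); ring.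
Qed.

Section Dihedral.
Variables (i j : 'I_n) (neq_ij : i != j).
Local Notation m := #[gen i * gen j]%g.
Let t : R := pi / m%:R.
Let T x := simple_refl i (simple_refl j x).

Local Lemma m_gt1 : (1 < m)%N.
Proof.
rewrite ltn_neqAle order_gt0 andbT eq_sym order_eq1 -eq_invg_mul genV.
by apply: contra neq_ij => /eqP /gen_inj ->.
Qed.

Local Lemma sint_neq0 : sin t != 0.
Proof.
rewrite gt_eqF //; apply: sin_gt0_pi; rewrite /t.
have m1 := m_gt1; have m0 : 0 < m%:R :> R by rewrite ltr0n ltnW.
rewrite divr_gt0 ?pi_gt0 //= ltr_pdivrMr //.
by rewrite ltr_pMr ?pi_gt0 // ltr1n.
Qed.

Local Lemma Bij : formB (simple i) (simple j) = - cos t :> R.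
Proof. exact: formB_simple. Qed.

Local Lemma iterTi k : iter k T (simple i) =
  (sin t)^-1 *: (sin (t + t *+ (2 * k)) *: simple i + sin (t *+ (2 * k)) *: simple j).
Proof.
elim: k => [|k IHk] /=.
  rewrite muln0 mulr0n addr0 sin0 scale0r addr0 scalerA mulVf ?scale1r //.
  exact: sint_neq0.
rewrite IHk /T !simple_reflZ !simple_reflD !simple_reflZ; congr (_ *: _).
rewrite /simple_refl -!scaleNr !(formBDl, formBZl) !formB_simple1.
rewrite (formBC (simple j)) Bij.
have -> : t *+ (2 * k.+1) = t *+ (2 * k) + t + t.
  by rewrite mulnS mulrnDr mulr2n addrC addrA.
rewrite !(addrC t) !(sinD, cosD).
set c := cos t; set s := sin t; set C := cos _; set S := sin _.
have s2 : s * s = 1 - c * c by rewrite -expr2 sin2cos2 expr2.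
by apply/rowP=> l; rewrite !mxE /=; ring: s2.
Qed.

Local Lemma iterTmi : iter m T (simple i) = simple i.
Proof.
rewrite iterTi; have -> : t *+ (2 * m) = pi *+ 2.
  rewrite mulnC mulrnA /t -(mulr_natr (pi / _)) divfK //.
  by rewrite pnatr_eq0 -lt0n order_gt0.
by rewrite sinD2pi sin2pi scale0r addr0 scalerA mulVf ?scale1r ?sint_neq0.
Qed.

End Dihedral.

Local Notation T i j := (fun x => simple_refl i (simple_refl j x)).

Local Lemma order_gen_sym (i j : 'I_n) :
  #[gen i * gen j]%g = #[gen j * gen i]%g.
Proof. by rewrite -[LHS]orderV invMg !genV. Qed.

Lemma iter_simple_reflD k i j x y :
  iter k (T i j) (x + y) = iter k (T i j) x + iter k (T i j) y.
Proof. by elim: k => //= k ->; rewrite !simple_reflD. Qed.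

Lemma iter_simple_reflZ k i j a x :
  iter k (T i j) (a *: x) = a *: iter k (T i j) x.
Proof. by elim: k => //= k ->; rewrite !simple_reflZ. Qed.

Lemma iter_simple_reflK k i j : cancel (iter k (T j i)) (iter k (T i j) : h -> h).
Proof. by elim: k => // k IHk x; rewrite iterSr iterS !simple_reflK IHk. Qed.

Lemma simple_refl_fix i x : formB x (simple i) = 0 -> simple_refl i x = x.
Proof. by move=> x0; rewrite /simple_refl x0 mulr0 scale0r subr0. Qed.

Lemma simple_refl_braid (i j : 'I_n) x :
  iter #[gen i * gen j]%g (T i j) x = x.
Proof.
have [<-|neq_ij] := eqVneq i j.
  by rewrite -{2}(genV i) mulgV order1 /= simple_reflK.
have iterTj : iter #[gen i * gen j]%g (T i j) (simple j) = simple j.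
  rewrite -{1}(@iterTmi j i) 1?eq_sym // order_gen_sym.
  exact: iter_simple_reflK.
have sn0 := sint_neq0 neq_ij.
set c := cos (pi / #[gen i * gen j]%g%:R) : R.
have c2n0 : 1 - c ^+ 2 != 0 by rewrite -sin2cos2 expf_eq0.
pose p := formB x (simple i); pose q := formB x (simple j).
pose a := (p + c * q) / (1 - c ^+ 2); pose b := (q + c * p) / (1 - c ^+ 2).
pose x0 := x - a *: simple i - b *: simple j.
have x0i : formB x0 (simple i) = 0.
  rewrite /x0 -!scaleNr !(formBDl, formBZl) formB_simple1.
  by rewrite (formBC (simple j)) formB_simple -/c -/p /a /b; field.
have x0j : formB x0 (simple j) = 0.
  rewrite /x0 -!scaleNr !(formBDl, formBZl) formB_simple1 formB_simple.
  by rewrite -/c -/q /a /b; field.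
have -> : x = x0 + b *: simple j + a *: simple i by rewrite /x0 !subrK.
clearbody x0; rewrite !iter_simple_reflD !iter_simple_reflZ iterTj iterTmi //.
congr (_ + _ + _).
by elim: #[_]%g => //= k ->; rewrite !simple_refl_fix.
Qed.


Definition simple_refl_mx (i : 'I_n) : 'M[R]_n :=
  1%:M - 2 *: (cox_mx R W *m (simple i)^T *m simple i).

Lemma mul_simple_refl_mx i x : x *m simple_refl_mx i = simple_refl i x.
Proof.
rewrite mulmxBr mulmx1 -scalemxAr !mulmxA [x *m _ *m _]mx11_scalar.
by rewrite mul_scalar_mx scalerA.
Qed.

Lemma mul_row_inj (A B : 'M[R]_n) : (forall x, x *m A = x *m B) -> A = B.
Proof. by move=> eqAB; apply/row_matrixP=> i; rewrite !rowE. Qed.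

Local Lemma simple_refl_mx_unit i : simple_refl_mx i \in unitmx.
Proof.
apply: (@mulmx1_unit _ _ _ (simple_refl_mx i) _).1.
by apply: mul_row_inj => x; rewrite mulmxA !mul_simple_refl_mx simple_reflK mulmx1.
Qed.

Local Lemma geom_mx_exists : exists phi : W -> glmx R n,
  {morph phi : u v / (u * v)%g} /\
  (forall i, phi (gen i) = Sub (simple_refl_mx i) (simple_refl_mx_unit i)).
Proof.
apply: gen_presentation => i j; apply: val_inj; apply: mul_row_inj => x.
rewrite val_glmx1 mulmx1 -[RHS](simple_refl_braid i j).
elim: #[_]%g => [|k IHk]; first by rewrite expg0 mulmx1.
by rewrite expgS !val_glmxM !mulmxA IHk !mul_simple_refl_mx.
Qed.

Lemma geom_spec : exists phi : W -> glmx R n,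
  [/\ {morph phi : u v / (u * v)%g},
      forall i x, x *m val (phi (gen i)) = simple_refl i x &
      forall w x, geom w x = x *m val (phi w)].
Proof.
have [phi [phiM phig]] := geom_mx_exists.
have phi_s i x : x *m val (phi (gen i)) = simple_refl i x.
  by rewrite phig mul_simple_refl_mx.
exists phi; split=> // w x; rewrite /geom -{2}(wprod_red_expr w).
elim: (red_expr w) => [|i a IHa] /=.
  have phi1 : phi 1%g = 1%g by apply: (mulIg (phi 1%g)); rewrite -phiM !mul1g.
  by rewrite /wprod big_nil phi1 mulmx1.
by rewrite IHa wprod_cons phiM val_glmxM mulmxA phi_s.
Qed.

Lemma geomM u v x : geom (u * v)%g x = geom u (geom v x).
Proof.
have [phi [phiM _ geomE]] := geom_spec.
by rewrite !geomE phiM val_glmxM mulmxA.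
Qed.

Lemma geom_gen i x : geom (gen i) x = simple_refl i x.
Proof. by have [phi [_ phi_s ->]] := geom_spec. Qed.

Lemma geom1 x : geom (1 : W)%g x = x.
Proof.
have [phi [phiM _ ->]] := geom_spec.
have -> : phi 1%g = 1%g by apply: (mulIg (phi 1%g)); rewrite -phiM !mul1g.
by rewrite mulmx1.
Qed.

Lemma geomD w x y : geom w (x + y) = geom w x + geom w y.
Proof. by have [phi [_ _ geomE]] := geom_spec; rewrite !geomE mulmxDl. Qed.

Lemma geomZ w a x : geom w (a *: x) = a *: geom w x.
Proof. by have [phi [_ _ geomE]] := geom_spec; rewrite !geomE scalemxAl. Qed.

Lemma geomK w : cancel (geom w) (geom w^-1%g : h -> h).
Proof. by move=> x; rewrite -geomM mulVg geom1. Qed.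

Lemma geomVK w : cancel (geom w^-1%g) (geom w : h -> h).
Proof. by move=> x; rewrite -geomM mulgV geom1. Qed.

Lemma formB_geom w x y : formB (geom w x) (geom w y) = formB x y.
Proof.
rewrite /geom; elim: (red_expr w) => //= i a IHa.
by rewrite simple_refl_isometry.
Qed.

End GeometryTheory.

(* s_a = u s_b u^-1 for a root a = u(b); the value at a non-root is junk.      *)
HB.lock Definition root_refl (R : realType) (W : coxeterSystem)
    (a : 'rV[R]_(rank W)) : W :=
  if [pick ui : W * 'I_(rank W) | geom ui.1 (simple ui.2) == a] is Some ui
  then (ui.1 * gen ui.2 * ui.1^-1)%g else 1%g.

Section RootReflections.
Variables (R : realType) (W : coxeterSystem).
Local Notation n := (rank W).
Local Notation h := 'rV[R]_n.
Implicit Types (x a : h) (u v w : W).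

Definition is_root a : bool :=
  [exists u : W, exists i : 'I_n, a == geom u (simple i)].

Lemma is_root_geom u i : is_root (geom u (simple i)).
Proof. by apply/existsP; exists u; apply/existsP; exists i. Qed.

Lemma is_root_simple i : is_root (simple i).
Proof. by rewrite -(geom1 (simple i)) is_root_geom. Qed.

Lemma geom_conj u i x :
  geom (u * gen i * u^-1)%g x =
  x - (2 * formB x (geom u (simple i))) *: geom u (simple i).
Proof.
rewrite !geomM geom_gen /simple_refl -scaleNr geomD geomZ geomVK scaleNr.
by rewrite -(formB_geom u) geomVK.
Qed.

Lemma geom_root_refl a x : is_root a ->
  geom (root_refl a) x = x - (2 * formB x a) *: a.
Proof.
case/existsP=> u /existsP[i /eqP ->]; rewrite root_refl.unlock.
case: pickP => [[u' i'] /= /eqP <-|/(_ (u, i))]; first exact: geom_conj.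
by rewrite eqxx.
Qed.

End RootReflections.

(* S(h) is the polynomial algebra on the simple roots, 'X_i standing for the   *)
(* i-th simple root; lform embeds h_R into it.                                 *)
Definition lform (R : realType) (n : nat) (x : 'rV[R]_n) : {mpoly R[i][n]} :=
  \sum_(i < n) (x 0 i)%:C%C *: 'X_i.

HB.lock Definition pact (R : realType) (W : coxeterSystem) (u : W)
    (f : {mpoly R[i][rank W]}) : {mpoly R[i][rank W]} :=
  f \mPo [tuple lform (geom u (simple i)) | i < rank W].

(* (f - s_a f) / a; for a root a this exact quotient exists (ddiffE).          *)
HB.lock Definition ddiff (R : realType) (W : coxeterSystem)
    (a : 'rV[R]_(rank W)) (f : {mpoly R[i][rank W]}) : {mpoly R[i][rank W]} :=
  xget 0 (fun g => lform a * g = f - pact (root_refl a) f).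

Section CoinvariantAlgebra.
Variables (R : realType) (W : coxeterSystem).
Local Notation n := (rank W).
Local Notation h := 'rV[R]_n.
Local Notation C := R[i].
Local Notation Sh := {mpoly C[n]}.
Implicit Types (x a : h) (u v w : W) (f g : Sh).

Definition invariant f : Prop := forall u, pact u f = f.

Definition coinv_ideal : {pred Sh} := fun f =>
  `[< exists gs : seq (Sh * Sh),
        (forall k, k \in gs -> invariant k.2 /\ k.2@_0%MM = 0) /\
        f = \sum_(k <- gs) k.1 * k.2 >].

Lemma coinv_ideal_closed : idealr_closed coinv_ideal.
Proof.
split.
- by apply/asboolP; exists [::]; split=> //; rewrite big_nil.
- apply/negP=> /asboolP[gs [gsP /(congr1 (mcoeff 0%MM))]].
  rewrite mcoeff1 eqxx raddf_sum /= big_seq big1 => [/eqP|k /gsP[_ k0]].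
    by rewrite oner_eq0.
  by rewrite rmorphM /= k0 mulr0.
move=> a f g /asboolP[fs [fsP ->]] /asboolP[gs [gsP ->]]; apply/asboolP.
exists ([seq (a * k.1, k.2) | k <- fs] ++ gs); split.
  by move=> k; rewrite mem_cat => /orP[/mapP[l /fsP lP ->]|/gsP].
rewrite big_cat big_map /= mulr_sumr; congr (_ + _).
by apply: eq_bigr => k _; rewrite mulrA.
Qed.

HB.instance Definition _ := isIdealr.Build Sh coinv_ideal coinv_ideal_closed.

Definition coinv := {ideal_quot coinv_ideal}.
HB.instance Definition _ := GRing.ComNzRing.on coinv.
HB.instance Definition _ := Quotient.on coinv.

(* The endomorphisms of coinv induced by pact u and ddiff a; see cactE, cddE.  *)
Definition cact u (z : coinv) : coinv := (\pi_coinv (pact u (repr z)))%qT.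
Definition cdd a (z : coinv) : coinv := (\pi_coinv (ddiff a (repr z)))%qT.


Lemma lformD x y : lform (x + y) = lform x + lform y.
Proof.
rewrite /lform -big_split; apply: eq_bigr => i _ /=.
by rewrite mxE rmorphD scalerDl.
Qed.

Lemma lformZ (c : R) x : lform (c *: x) = c%:C%C *: lform x.
Proof.
rewrite /lform scaler_sumr; apply: eq_bigr => i _ /=.
by rewrite mxE rmorphM scalerA.
Qed.

Lemma lform_simple (i : 'I_n) : lform (simple i : h) = 'X_i.
Proof.
rewrite /lform (bigD1 i) //= big1 => [|j neq_ji]; rewrite mxE !eqxx /=.
  by rewrite scale1r addr0.
by rewrite (negPf neq_ji) scale0r.
Qed.

Lemma lform_sum (I : Type) (r : seq I) (F : I -> h) :
  lform (\sum_(i <- r) F i) = \sum_(i <- r) lform (F i).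
Proof.
elim/big_rec2: _ => [|i x y _ <-]; last by rewrite lformD.
by rewrite /lform big1 // => i _; rewrite mxE scale0r.
Qed.

Lemma lform_eq0 x : lform x = 0 -> x = 0.
Proof.
move=> x0; apply/rowP=> i; have /(congr1 (mcoeff U_(i)%MM)) := x0.
rewrite mcoeff0 raddf_sum /= (bigD1 i) //= big1 => [|j neq_ji].
  by rewrite mcoeffZ mcoeffX eqxx mulr1 addr0 mxE => /complexI.
rewrite mcoeffZ mcoeffX; case: eqP => [/eqP|]; last by rewrite mulr0.
by rewrite eq_mnm1 (negPf neq_ji).
Qed.

Lemma pactC u (c : C) : pact u c%:MP = c%:MP.
Proof. by rewrite pact.unlock comp_mpolyC. Qed.

Lemma pact_sum u (I : Type) (r : seq I) (F : I -> Sh) :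
  pact u (\sum_(k <- r) F k) = \sum_(k <- r) pact u (F k).
Proof. by rewrite pact.unlock raddf_sum. Qed.

Lemma pactD u f g : pact u (f + g) = pact u f + pact u g.
Proof. by rewrite pact.unlock raddfD. Qed.

Lemma pactB u f g : pact u (f - g) = pact u f - pact u g.
Proof. by rewrite pact.unlock raddfB. Qed.

Lemma pactZ u (c : C) f : pact u (c *: f) = c *: pact u f.
Proof. by rewrite pact.unlock linearZ. Qed.

Lemma pactMr u f g : pact u (f * g) = pact u f * pact u g.
Proof. by rewrite pact.unlock rmorphM. Qed.

Lemma pact_lform u x : pact u (lform x) = lform (geom u x).
Proof.
have [phi [_ _ geomE]] := geom_spec R W.
rewrite {1}/lform pact.unlock raddf_sum /= geomE [x in RHS]matrix_sum_delta.
rewrite big_ord1 mulmx_suml lform_sum; apply: eq_bigr => i _ /=.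
rewrite linearZ /= comp_mpolyXU -tnth_nth tnth_mktuple geomE.
by rewrite -scalemxAl lformZ.
Qed.

Lemma poly_ind_alg (P : Sh -> Prop) :
  (forall c : C, P c%:MP) -> (forall i, P 'X_i) ->
  (forall f g, P f -> P g -> P (f + g)) ->
  (forall f g, P f -> P g -> P (f * g)) -> forall f, P f.
Proof.
move=> PC PX PD PM f; rewrite (mpolyE f); apply: (big_ind P) => //.
  by rewrite -mpolyC0.
move=> m _; rewrite -mul_mpolyC mpolyXE_id; apply: (PM) => //.
have P1 : P 1 by rewrite -mpolyC1.
by apply: (big_ind P P1 PM) => i _; elim: (m i) => // k IHk; rewrite exprS; apply: (PM).
Qed.

Lemma pactM u v f : pact (u * v)%g f = pact u (pact v f).
Proof.
elim/poly_ind_alg: f => [c|i|f g IHf IHg|f g IHf IHg].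
- by rewrite !pactC.
- by rewrite -lform_simple !pact_lform geomM.
- by rewrite !pactD IHf IHg.
- by rewrite !pactMr IHf IHg.
Qed.

Lemma pact1 f : pact 1%g f = f.
Proof.
elim/poly_ind_alg: f => [c|i|f g IHf IHg|f g IHf IHg].
- by rewrite pactC.
- by rewrite -lform_simple pact_lform geom1.
- by rewrite pactD IHf IHg.
- by rewrite pactMr IHf IHg.
Qed.

Lemma eq_geom_pact u v f : geom (R := R) u =1 geom v -> pact u f = pact v f.
Proof.
move=> euv; pose t w := [tuple lform (geom w (simple i : h)) | i < n].
suff etuv : t u = t v by rewrite pact.unlock -/(t u) etuv.
by apply: eq_from_tnth => i; rewrite !tnth_mktuple euv.
Qed.

Lemma pactK u : cancel (pact u : Sh -> Sh) (pact u^-1%g).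
Proof. by move=> f; rewrite -pactM mulVg pact1. Qed.

Lemma pact_gen_div i f : exists g, 'X_i * g = f - pact (gen i) f.
Proof.
elim/poly_ind_alg: f => [c|j|f1 f2 [g1 e1] [g2 e2]|f1 f2 [g1 e1] [g2 e2]].
- by exists 0; rewrite mulr0 pactC subrr.
- exists ((2 * formB (simple j : h) (simple i))%:C%C)%:MP.
  rewrite -[in RHS]lform_simple pact_lform geom_gen /simple_refl -scaleNr.
  by rewrite lformD lformZ !lform_simple opprD addNKr rmorphN scaleNr opprK mulrC mul_mpolyC.
- by exists (g1 + g2); rewrite mulrDr e1 e2 pactD opprD addrACA.
exists (g1 * f2 + pact (gen i) f1 * g2).
by rewrite mulrDr mulrA e1 mulrCA e2 pactMr mulrBl mulrBr addrA subrK.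
Qed.

Lemma lform_root_neq0 a : is_root a -> lform a != 0.
Proof.
case/existsP=> u /existsP[i /eqP ->]; apply/eqP => /lform_eq0 ui0.
have /eqP := formB_simple1 R i.
by rewrite -(formB_geom u) ui0 /formB !mul0mx mxE eq_sym oner_eq0.
Qed.

Lemma ddiffE a f : is_root a ->
  lform a * ddiff a f = f - pact (root_refl a) f.
Proof.
move=> a_root; rewrite ddiff.unlock; apply: (@xgetPex _ 0 (fun g => lform a * g = f - pact (root_refl a) f)).
have := geom_root_refl _ a_root; move: (root_refl a) => s sE.
case/existsP: a_root => u /existsP[i /eqP aE].
have [g eg] := pact_gen_div i (pact u^-1%g f); exists (pact u g).
rewrite aE -pact_lform -pactMr lform_simple eg pactB.
have -> : pact u (pact u^-1%g f) = f by rewrite -pactM mulgV pact1.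
have -> : pact s f = pact (u * (gen i * u^-1))%g f.
  by apply: eq_geom_pact => x; rewrite sE aE mulgA geom_conj.
by rewrite pactM (pactM (gen i)).
Qed.

Lemma ddiff_unique a f g : is_root a ->
  lform a * g = f - pact (root_refl a) f -> ddiff a f = g.
Proof.
move=> a_root eg; apply: (mulfI (lform_root_neq0 a_root)).
by rewrite ddiffE.
Qed.

Lemma ddiffD a f g : is_root a -> ddiff a (f + g) = ddiff a f + ddiff a g.
Proof.
move=> a_root; apply: ddiff_unique => //.
by rewrite mulrDr !ddiffE // pactD opprD addrACA.
Qed.

Lemma ddiffB a f g : is_root a -> ddiff a (f - g) = ddiff a f - ddiff a g.
Proof.
move=> a_root; apply: ddiff_unique => //.
by rewrite mulrBr !ddiffE // pactB !opprD addrACA.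
Qed.

Lemma ddiffZ a (c : C) f : is_root a -> ddiff a (c *: f) = c *: ddiff a f.
Proof.
move=> a_root; apply: ddiff_unique => //.
by rewrite -scalerAr ddiffE // pactZ scalerBr.
Qed.

Lemma pact_coinv_ideal u f : f \in coinv_ideal -> pact u f \in coinv_ideal.
Proof.
case/asboolP=> gs [gsP ->]; rewrite pact_sum big_seq.
apply: rpred_sum => k k_gs; rewrite pactMr.
apply: idealMr; apply/asboolP; exists [:: (1, pact u k.2)].
split=> [l|]; last by rewrite big_seq1 mul1r.
by rewrite inE => /eqP -> /=; have [inv0 ?] := gsP _ k_gs; rewrite inv0.
Qed.

Lemma ddiff_coinv_ideal a f :
  is_root a -> f \in coinv_ideal -> ddiff a f \in coinv_ideal.
Proof.
move=> a_root /asboolP[gs [gsP ->]]; apply/asboolP.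
exists [seq (ddiff a k.1, k.2) | k <- gs]; split.
  by move=> l /mapP[k /gsP kP ->].
apply: ddiff_unique => //; rewrite big_map /= mulr_sumr.
rewrite pact_sum -sumrB [LHS]big_seq [RHS]big_seq; apply: eq_bigr => k.
by case/gsP=> inv0 _; rewrite mulrA ddiffE // mulrBl pactMr inv0.
Qed.

Lemma coinv_reprB f : repr (\pi_coinv f)%qT - f \in coinv_ideal.
Proof. by rewrite Quotient.idealrBE reprK. Qed.

Lemma cactE u f : cact u (\pi_coinv f)%qT = (\pi_coinv (pact u f))%qT.
Proof.
apply/eqP; rewrite -Quotient.idealrBE -pactB.
exact/pact_coinv_ideal/coinv_reprB.
Qed.

Lemma cddE a f : is_root a -> cdd a (\pi_coinv f)%qT = (\pi_coinv (ddiff a f))%qT.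
Proof.
move=> a_root; apply/eqP.
rewrite -Quotient.idealrBE -ddiffB //.
exact/ddiff_coinv_ideal/coinv_reprB.
Qed.

End CoinvariantAlgebra.

Section SkewDividedDifference.
Variables (R : realType) (W : coxeterSystem).
Local Notation n := (rank W).
Implicit Types (v w : W) (a : seq 'I_n).

Definition subword a (J : {set 'I_(size a)}) : seq 'I_n :=
  [seq tnth (in_tuple a) j | j <- enum J].

Definition skew_term a (J : {set 'I_(size a)}) : coinv R W -> coinv R W :=
  \big[comp/id]_(j < size a)
    let i := tnth (in_tuple a) j in
    if j \in J then cact (gen i) else cdd (simple i).

Definition skew_ddiff w v (z : coinv R W) : coinv R W :=
  if bruhat_le v w then
    cact v^-1%g
      (\sum_(J : {set 'I_(size (red_expr w))} | reduced_expr (subword J) v)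
         skew_term J z)
  else 0.

End SkewDividedDifference.

(* Main.v *)
Require Import Defs.
From HB Require Import structures.
From mathcomp Require Import all_boot all_order all_algebra all_fingroup.
From mathcomp Require Import generic_quotient boolp classical_sets reals trigo.
From mathcomp Require Import complex mpoly.
From mathcomp Require Import zify ring.

(** The operator P(a, v) obtained from a word a by summing over the subwords of
a that are reduced for v obeys a recursion on the first letter i of a: with
a = i :: c, it is d_i P(c, v), plus s_i P(c, s_i v) when s_i v < v
([word_skew], [sum_skew_term]).  If P(a, v) depends only on v and on the
element w spelled by the reduced word a, one may use a reduced word of w
(or of w') that begins with b.  Applying the recursion once to v and to
v' = s_b v then gives the theorem by a computation from d_b d_b = 0,
d_b s_b = - d_b, s_b d_b = d_b and d_alpha v'^-1 = - v^-1 d_b; the last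
identity holds because v maps alpha to the simple root b.

The substance is that P(a, v) does not depend on the reduced word a and
vanishes when a is not reduced ([word_skew_reduced]).  Moving a linear form to
the left through P(a, v), where a spells w, produces
  P(a, v) (w^-1 l) = l P(a, v) - sum_k 2 B(l, g_k) P(a_k, v),
where a_k is a without its k-th letter and g_k is the root
s_1 ... s_(k-1)(alpha_k) ([word_skew_lform]).  By induction on the length,
P(a_k, v) depends only on the element spelled by a_k, which is t_k w with t_k
the reflection in g_k.  So the correction sum is the same for two reduced words
of w as soon as the function t |-> sum of the g_k with t_k = t depends on w
alone.  Granting this, the difference D of the two operators satisfies
D (w^-1 l) = l D and D(1) = 0, hence D = 0, because the linear forms generate
the coinvariant algebra ([twisted_scalar_eq0]).

That function of t is a 1-cocycle of W with values in the functions from W to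
the geometric representation, and its independence of the word is an instance
of the universal property of the Coxeter presentation, applied to the
corresponding semidirect product; what has to be checked is a rank two identity
([cocycle_gen_order]).

Finally, when v is not below w the operator is zero by convention, and one has
to know that P(a, v) is then zero as well.  This follows from the lifting
property of the Bruhat order ([bruhat_lift]), which rests on the strong exchange
condition, and the latter is read off the same cocycle ([strong_exchange]). *)

Set Implicit Arguments.
Unset Strict Implicit.
Unset Printing Implicit Defensive.

Import GRing.Theory Num.Theory.

Local Open Scope ring_scope.


(** * Length and descents *)

Section Length.
Variable W : coxeterSystem.
Implicit Types (u v w x y t : W) (a c : seq 'I_(rank W)) (i j : 'I_(rank W)).

Lemma wprod_nil : wprod [::] = 1%g :> W.
Proof. by rewrite /wprod big_nil. Qed.

Lemma wprod_cat a c : wprod (a ++ c) = (wprod a * wprod c)%g.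
Proof. by rewrite /wprod big_cat. Qed.

Lemma gen_mulK i : involutive (fun w => gen i * w)%g.
Proof. by move=> w; rewrite -{1}(Defs.genV i) mulKg. Qed.

Lemma gen_sq i : (gen i * gen i = 1 :> W)%g.
Proof. by rewrite -{1}Defs.genV mulVg. Qed.

Lemma len_wprod a : (len (wprod a) <= size a)%N.
Proof.
rewrite /len; case: ex_minnP => k _; apply.
by apply/existsP; exists (in_tuple a).
Qed.

Lemma size_red_expr w : size (red_expr w) = len w.
Proof. by have /andP[_ /eqP] := red_exprP w. Qed.

Lemma len_gen_mul i w : (len (gen i * w)%g <= (len w).+1)%N.
Proof.
rewrite -{1}(wprod_red_expr w) -wprod_cons.
by rewrite (leq_trans (len_wprod _)) //= size_red_expr.
Qed.

(** The generators may be sent to one transposition, because the defining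
relations have even length; the resulting sign is the parity of the length. *)
Lemma odd_len_wprod a : odd (len (wprod a)) = odd (size a).
Proof.
have [i j|phi [phiM phig]] := @gen_presentation W {perm bool} (fun=> tperm false true).
  by rewrite tperm2 expg1n.
have phiE c : odd_perm (phi (wprod c)) = odd (size c).
  elim: c => [|i c IHc] /=.
    rewrite wprod_nil; have -> : phi 1%g = 1%g.
      by apply: (mulIg (phi 1%g)); rewrite -phiM !mul1g.
    by rewrite odd_perm1.
  by rewrite wprod_cons phiM odd_permM IHc phig odd_tperm.
by rewrite -size_red_expr -phiE wprod_red_expr.
Qed.

Lemma odd_lenM x y : odd (len (x * y)%g) = odd (len x) (+) odd (len y).
Proof.
rewrite -(wprod_red_expr x) -(wprod_red_expr y) -wprod_cat !odd_len_wprod.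
by rewrite size_cat oddD.
Qed.

Lemma odd_len_gen i : odd (len (gen i : W)).
Proof. by rewrite -[gen i]mulg1 -wprod_nil -wprod_cons odd_len_wprod. Qed.

Lemma odd_len_reflection t : is_reflection t -> odd (len t).
Proof.
case/existsP=> u /existsP[i /eqP ->].
have : odd (len (u^-1 * u)%g) = false by rewrite mulVg -wprod_nil odd_len_wprod.
by rewrite !odd_lenM odd_len_gen; do 2 case: odd.
Qed.

Lemma reflection_sq t : is_reflection t -> (t * t = 1)%g.
Proof.
case/existsP=> u /existsP[i /eqP ->].
by rewrite !mulgA mulgKV -(mulgA u) gen_sq mulg1 mulgV.
Qed.

Definition descent i w := (len (gen i * w)%g < len w)%N.

Lemma descent_len i w : descent i w -> len w = (len (gen i * w)%g).+1.
Proof.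
move=> d; apply/eqP; rewrite eqn_leq; apply/andP; split=> //.
by rewrite -{1}[w](gen_mulK i) len_gen_mul.
Qed.

Lemma ascent_len i w : ~~ descent i w -> len (gen i * w)%g = (len w).+1.
Proof.
rewrite /descent -leqNgt leq_eqVlt => /orP[/eqP e|lt_w].
  have := odd_lenM (gen i) w; rewrite odd_len_gen -e.
  by case: odd.
by apply/eqP; rewrite eqn_leq lt_w len_gen_mul.
Qed.

Lemma descentC i w : descent i (gen i * w)%g = ~~ descent i w.
Proof.
rewrite {1}/descent gen_mulK; apply/idP/idP => [lt_w|/ascent_len -> //].
by rewrite /descent -leqNgt ltnW.
Qed.

Definition reduced a := reduced_expr a (wprod a).

Lemma reducedE a : reduced a = (size a == len (wprod a)).
Proof. by rewrite /reduced /reduced_expr eqxx. Qed.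

Lemma reduced_size a : reduced a -> size a = len (wprod a).
Proof. by rewrite reducedE => /eqP. Qed.

Lemma reduced_exprP a w : reflect (wprod a = w /\ reduced a) (reduced_expr a w).
Proof.
apply: (iffP andP) => [[/eqP <- /eqP sa]|[<-]]; first by rewrite reducedE sa.
by rewrite reducedE eqxx.
Qed.

Lemma reduced_expr_cons i a w :
  reduced_expr (i :: a) w = descent i w && reduced_expr a (gen i * w)%g.
Proof.
rewrite /reduced_expr wprod_cons /= -(inj_eq (can_inj (gen_mulK i))) gen_mulK.
have [e|_] /= := eqVneq (wprod a) (gen i * w)%g; last by rewrite andbF.
have := len_wprod a; rewrite e.
by have [d|/ascent_len ->] := boolP (descent i w); [rewrite (descent_len d)|lia].
Qed.

Lemma reduced_expr1 w : reduced_expr [::] w = (w == 1%g).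
Proof.
rewrite /reduced_expr wprod_nil eq_sym; case: eqP => // ->.
by rewrite eq_sym -leqn0 -wprod_nil len_wprod.
Qed.

Lemma reduced_cons i a :
  reduced (i :: a) = ~~ descent i (wprod a) && reduced a.
Proof.
by rewrite /reduced reduced_expr_cons wprod_cons gen_mulK descentC.
Qed.

End Length.

(** * The root cocycle *)

Section RootCocycle.
Variables (R : realType) (W : coxeterSystem).
Local Notation n := (rank W).
Local Notation h := 'rV[R]_n.
Implicit Types (x y : h) (u v w t : W) (a c : seq 'I_n) (i j : 'I_n).

Definition rootfun := {ffun W -> h}.
Implicit Types (f g : rootfun).

(** The action of W induced by conjugation on the source and the geometric
representation on the target. *)
Definition twist u f : rootfun := [ffun t => geom u (f (t ^ u)%g)].

Lemma twistM u v f : twist (u * v)%g f = twist u (twist v f).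
Proof. by apply/ffunP=> t; rewrite !ffunE geomM conjgM. Qed.

Lemma twist1 f : twist 1%g f = f.
Proof. by apply/ffunP=> t; rewrite ffunE geom1 conjg1. Qed.

Lemma geomN u x : geom u (- x) = - geom u x.
Proof. by rewrite -scaleN1r geomZ scaleN1r. Qed.

Lemma geom0 u : geom u (0 : h) = 0.
Proof. by rewrite -[X in geom _ X](subrr (0 : h)) geomD geomN subrr. Qed.

Lemma twist_zmod_morphism u : zmod_morphism (twist u).
Proof. by move=> f g; apply/ffunP=> t; rewrite !ffunE geomD geomN. Qed.

Lemma twistN u f : twist u (- f) = - twist u f.
Proof. by apply/ffunP=> t; rewrite !ffunE geomN. Qed.

HB.instance Definition _ u :=
  GRing.isZmodMorphism.Build rootfun rootfun (twist u) (@twist_zmod_morphism u).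

Definition delta t x : rootfun := [ffun t' => if t' == t then x else 0].

Lemma twist_delta u t x : twist u (delta t x) = delta (u * t * u^-1)%g (geom u x).
Proof.
apply/ffunP=> t'; rewrite !ffunE -(inj_eq (conjg_inj u^-1%g)).
rewrite conjgK conjgE invgK mulgA.
by case: eqP => // _; rewrite geom0.
Qed.

Lemma deltaN t x : delta t (- x) = - delta t x.
Proof. by apply/ffunP=> t'; rewrite !ffunE; case: eqP; rewrite ?oppr0. Qed.

(** The semidirect product of W and [rootfun]: a homomorphism to it that lifts
the identity of W is the same thing as a 1-cocycle. *)
Definition cocycleGroup : Type := (W * rootfun)%type.
HB.instance Definition _ := Choice.on cocycleGroup.
Implicit Types p q r : cocycleGroup.

Let one : cocycleGroup := (1%g, 0).
Let mul p q : cocycleGroup := ((p.1 * q.1)%g, p.2 + twist p.1 q.2).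
Let inv p : cocycleGroup := ((p.1^-1)%g, - twist p.1^-1%g p.2).

Local Lemma cocycle_mulA : associative mul.
Proof. by move=> p q r; rewrite /mul /= mulgA twistM raddfD addrA. Qed.
Local Lemma cocycle_mul1 : left_id one mul.
Proof. by case=> u f; rewrite /mul /= mul1g twist1 add0r. Qed.
Local Lemma cocycle_mulr1 : right_id one mul.
Proof. by case=> u f; rewrite /mul /= mulg1 raddf0 addr0. Qed.
Local Lemma cocycle_mulV : left_inverse one inv mul.
Proof. by case=> u f; rewrite /mul /= mulVg addNr. Qed.
Local Lemma cocycle_mulrV : right_inverse one inv mul.
Proof. by case=> u f; rewrite /mul /= mulgV twistN -twistM mulgV twist1 subrr. Qed.

HB.instance Definition _ := isGroup.Build cocycleGroup
  cocycle_mulA cocycle_mul1 cocycle_mulr1 cocycle_mulV cocycle_mulrV.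

Lemma cocycle_expg (p : cocycleGroup) k :
  (p ^+ k)%g = (p.1 ^+ k, \sum_(q < k) twist (p.1 ^+ q)%g p.2)%g :> cocycleGroup.
Proof.
elim: k => [|k IHk]; first by rewrite big_ord0.
by rewrite expgSr IHk big_ord_recr expgSr.
Qed.

Definition simple_delta i : rootfun := delta (gen i) (simple i).

Lemma simple_refl_simple i : simple_refl i (simple i) = - simple i :> h.
Proof.
rewrite /simple_refl formB_simple1 mulr1 scaler_nat mulr2n.
by rewrite opprD addrA subrr add0r.
Qed.

Lemma twist_simple_delta i : twist (gen i) (simple_delta i) = - simple_delta i.
Proof.
by rewrite /simple_delta twist_delta -deltaN mulgK geom_gen simple_refl_simple.
Qed.

Section Dihedral.
Variables i j : 'I_n.
Let c : W := (gen i * gen j)%g.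
Let m := #[c]%g.

Lemma sum_twist_shift k f :
  \sum_(q < m) twist (c ^+ q)%g (twist (c ^+ k)%g f) =
  \sum_(q < m) twist (c ^+ q)%g f.
Proof.
have shift1 g : \sum_(q < m) twist (c ^+ q)%g (twist c g) =
                \sum_(q < m) twist (c ^+ q)%g g.
  under eq_bigr => q _ do rewrite -twistM -expgSr.
  rewrite /m; move: (prednK (order_gt0 c)) (expg_order c) => <- c1.
  by rewrite big_ord_recr big_ord_recl /= c1 expg0 addrC.
by elim: k => [|k IHk]; rewrite ?twist1 // expgS twistM shift1.
Qed.

Lemma geom_expg_rot k x :
  geom (c ^+ k)%g x = iter k (fun x => simple_refl i (simple_refl j x)) x.
Proof.
by elim: k => [|k IHk]; rewrite ?geom1 // expgS !geomM !geom_gen IHk.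
Qed.

Lemma conj_rot k s : (c * s * c = s)%g ->
  (c ^+ k * s * (c ^+ k)^-1 = s * (c ^+ (2 * k))^-1)%g.
Proof.
move=> csc; have cksck : (c ^+ k * s * c ^+ k = s)%g.
  elim: k => [|k IHk]; first by rewrite mul1g mulg1.
  rewrite {1}expgS expgSr.
  have -> : (c * c ^+ k * s * (c ^+ k * c) = c * (c ^+ k * s * c ^+ k) * c)%g.
    by rewrite !mulgA.
  by rewrite IHk.
rewrite -[in RHS]cksck mul2n -addnn expgD invMg !mulgA; congr (_ * _)%g.
by rewrite mulgK.
Qed.

Lemma rot_conj_geni : (c * gen i * c = gen i)%g.
Proof. by rewrite /c -!mulgA gen_mulK gen_sq mulg1. Qed.

Lemma rot_conj_genj : (c * gen j * c = gen j)%g.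
Proof. by rewrite /c -!mulgA (gen_mulK j) (gen_mulK i). Qed.

Lemma rot_angle : (pi / m%:R : R) *+ m = pi.
Proof. by rewrite -(mulr_natr (pi / _)) divfK // pnatr_eq0 -lt0n order_gt0. Qed.

(** In the plane of two simple roots, c is the rotation by 2 pi / m.  For odd m,
its power (m - 1) / 2 is the rotation by pi - pi / m, which is the angle from
one simple root to the other; for even m, its power m / 2 is the half turn. *)
Lemma rot_simple_odd k : i != j -> m = (2 * k).+1 ->
  geom (c ^+ k)%g (simple i) = simple j :> h.
Proof.
move=> neq_ij mk; rewrite geom_expg_rot Defs.iterTi // -/c -/m.
have := Defs.sint_neq0 R neq_ij; rewrite -/c -/m => s0.
have := rot_angle; rewrite {2}mk mulrS => ->.
rewrite sinpi scale0r add0r scalerA.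
have -> : (pi / m%:R : R) *+ (2 * k) = pi - pi / m%:R.
  by apply/eqP; rewrite eq_sym subr_eq -mulrSr -mk rot_angle.
by rewrite sinB sinpi cospi mul0r mulN1r sub0r opprK mulVf ?scale1r.
Qed.

Lemma rot_simple_even k : i != j -> m = (2 * k)%N ->
  geom (c ^+ k)%g (simple i) = - simple i :> h.
Proof.
move=> neq_ij mk; rewrite geom_expg_rot Defs.iterTi // -/c -/m.
have := Defs.sint_neq0 R neq_ij; rewrite -/c -/m => s0.
have := rot_angle; rewrite {2}mk => ->.
by rewrite sinDpi sinpi scale0r addr0 scalerA mulrN mulVf ?scaleN1r.
Qed.

(** The half turn changes the sign of the summand and permutes the sum, which
therefore equals its own opposite. *)
Lemma sum_twist_delta0 s x k : (c * s * c = s)%g ->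
  geom (c ^+ k)%g x = - x -> m = (2 * k)%N ->
  \sum_(q < m) twist (c ^+ q)%g (delta s x) = 0.
Proof.
move=> csc ckx mk; set S := (S in S = 0).
suff /eqP: S = - S.
  rewrite -subr_eq0 opprK -mulr2n -scaler_nat scaler_eq0 pnatr_eq0 /=.
  by move/eqP.
rewrite /S -sumrN -(sum_twist_shift k); apply: eq_bigr => q _.
rewrite twist_delta ckx deltaN twistN.
by rewrite conj_rot // -mk expg_order invg1 mulg1.
Qed.

End Dihedral.

(** For odd m a power of c carries the first delta function to the second, so
the two orbit sums agree; for even m both sums vanish. *)
Lemma sum_twist_simple_delta i j : let c : W := (gen i * gen j)%g in
  \sum_(q < #[c]%g) twist (c ^+ q)%g (simple_delta i) =
  \sum_(q < #[c]%g) twist (c ^+ q)%g (simple_delta j).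
Proof.
move=> c; have [<- //|neq_ij] := eqVneq i j.
have := odd_double_half #[c]%g; rewrite -mul2n; case: odd => /esym mk.
  rewrite -(sum_twist_shift i j (#[c]%g./2)); apply: eq_bigr => q _.
  rewrite /simple_delta twist_delta (rot_simple_odd neq_ij) //.
  rewrite conj_rot ?rot_conj_geni //; congr (twist _ (delta _ _)).
  apply: (mulgI (gen i)); rewrite gen_mulK; apply/eqP.
  by rewrite eq_invg_mul -expgSr -add1n -mk expg_order.
have cV : (gen j * gen i)%g = c^-1%g by rewrite invMg !Defs.genV.
rewrite (sum_twist_delta0 (rot_conj_geni i j) (rot_simple_even neq_ij mk) mk).
rewrite (@sum_twist_delta0 _ _ _ _ #[c]%g./2 (rot_conj_genj i j)) //.
have <- : ((gen j * gen i) ^+ #[c]%g./2 = c ^+ #[c]%g./2)%g.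
  rewrite cV expgVn; apply/eqP; rewrite eq_invg_mul -expgD addnn -mul2n.
  by rewrite [X in (_ ^+ X)%g](esym mk) expg_order.
by apply: rot_simple_even; rewrite 1?eq_sym // cV orderV.
Qed.

Definition cocycle_gen i : cocycleGroup := (gen i, simple_delta i).

(** The second component of the power is the orbit sum of the i-th delta
function minus that of the j-th one. *)
Lemma cocycle_gen_order i j :
  ((cocycle_gen i * cocycle_gen j) ^+ #[gen i * gen j])%g = 1%g.
Proof.
set c := (gen i * gen j)%g; rewrite cocycle_expg /= -/c expg_order.
rewrite [X in (_, X)](_ : _ = 0) //.
have -> : twist (gen i) (simple_delta j) = - twist c (simple_delta j).
  by rewrite twistM twist_simple_delta twistN opprK.
under eq_bigr => q _ do rewrite raddfB /=.
rewrite sumrB sum_twist_simple_delta; apply/eqP.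
rewrite subr_eq0 eq_sym; apply/eqP.
exact: (sum_twist_shift i j 1).
Qed.

Fixpoint word_cocycle a : rootfun :=
  if a is i :: c then simple_delta i + twist (gen i) (word_cocycle c) else 0.

Lemma root_cocycle_exists : exists E : W -> rootfun,
  (forall u v, E (u * v)%g = E u + twist u (E v)) /\
  (forall a, word_cocycle a = E (wprod a)).
Proof.
have [phi [phiM phig]] := gen_presentation cocycle_gen_order.
have phi1 u : (phi u).1 = u.
  rewrite -(wprod_red_expr u); elim: (red_expr u) => [|i a IHa].
    rewrite wprod_nil; suff -> : phi 1%g = 1%g by [].
    by apply: (mulIg (phi 1%g)); rewrite -phiM !mul1g.
  by rewrite wprod_cons phiM phig /= IHa.
have EM u v : (phi (u * v)%g).2 = (phi u).2 + twist u (phi v).2.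
  by rewrite -{3}(phi1 u) phiM.
exists (fun u => (phi u).2); split=> //.
elim=> [|i a IHa] /=.
  have := EM 1%g 1%g; rewrite mulg1 twist1 wprod_nil.
  by rewrite -{1}[(phi _).2]addr0 => /addrI.
by rewrite wprod_cons EM phig IHa.
Qed.

(** All ways to delete one letter of a: the root s_1 ... s_(k-1)(alpha_k) is
recorded with the word that remains when the k-th letter is deleted. *)
Fixpoint deletions a : seq (h * seq 'I_n) :=
  if a is i :: c then
    (simple i, c) :: [seq (simple_refl i d.1, i :: d.2) | d <- deletions c]
  else [::].

Lemma size_deletions a d : d \in deletions a -> (size d.2).+1 = size a.
Proof.
elim: a d => //= i a IHa d; rewrite inE => /orP[/eqP -> //|].
by case/mapP=> e /IHa e1 -> /=; rewrite e1.
Qed.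

(** Deleting the letter with root g multiplies the spelled element by the
reflection in g on the left, which is why t names the reflection of d. *)
Lemma word_cocycle_deletions a t :
  word_cocycle a t =
  \sum_(d <- deletions a | wprod d.2 == (t * wprod a)%g) d.1.
Proof.
elim: a t => [|i a IHa] t /=; first by rewrite big_nil ffunE.
rewrite big_cons big_map !ffunE IHa /=.
have -> : (wprod a == t * wprod (i :: a))%g = (t == gen i).
  rewrite wprod_cons mulgA -{1}[wprod a]mul1g (inj_eq (mulIg _)) eq_sym.
  by rewrite -(Defs.genV i) -eq_mulgV1 Defs.genV.
have -> : geom (gen i)
    (\sum_(d <- deletions a | wprod d.2 == (t ^ gen i * wprod a)%g) d.1) =
  \sum_(d <- deletions a | wprod (i :: d.2) == (t * wprod (i :: a))%g)
    simple_refl i d.1.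
  rewrite (big_morph (geom (gen i)) (geomD _) (geom0 _)).
  apply: eq_big => [d|d _]; last by rewrite geom_gen.
  rewrite !wprod_cons -(inj_eq (can_inj (gen_mulK i))) conjgE Defs.genV.
  by rewrite -!mulgA gen_mulK.
by case: eqP => _; rewrite ?add0r.
Qed.

Definition root_cocycle w : rootfun := word_cocycle (red_expr w).

Lemma word_cocycleE a : word_cocycle a = root_cocycle (wprod a).
Proof.
have [E [_ EE]] := root_cocycle_exists.
by rewrite /root_cocycle !EE wprod_red_expr.
Qed.

Lemma root_cocycleM u v :
  root_cocycle (u * v)%g = root_cocycle u + twist u (root_cocycle v).
Proof.
have [E [EM EE]] := root_cocycle_exists.
by rewrite /root_cocycle !EE !wprod_red_expr EM.
Qed.

Lemma root_cocycle1 : root_cocycle 1%g = 0.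
Proof. by rewrite -wprod_nil -word_cocycleE. Qed.

Lemma root_cocycle_gen i : root_cocycle (gen i) = simple_delta i.
Proof.
have -> : gen i = wprod [:: i] :> W by rewrite wprod_cons wprod_nil mulg1.
by rewrite -word_cocycleE /= raddf0 addr0.
Qed.

Lemma root_cocycleV u : root_cocycle u^-1%g = - twist u^-1%g (root_cocycle u).
Proof. by apply/eqP; rewrite -addr_eq0 -root_cocycleM mulVg root_cocycle1. Qed.

Lemma root_cocycle_neq0 a t : root_cocycle (wprod a) t != 0 ->
  exists2 d, d \in deletions a & wprod d.2 = (t * wprod a)%g.
Proof.
rewrite -word_cocycleE word_cocycle_deletions.
have [/hasP[d d_in /eqP dE]|/hasPn no_d] :=
  boolP (has (fun d => wprod d.2 == (t * wprod a)%g) (deletions a)).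
  by exists d.
by rewrite big1_seq ?eqxx // => d /andP[dE /no_d]; rewrite dE.
Qed.

Lemma simple_neq0 i : simple i != 0 :> h.
Proof.
apply/eqP=> i0; have /eqP := formB_simple1 R i.
by rewrite i0 -{1}(scale0r 0) formBZl mul0r eq_sym oner_eq0.
Qed.

(** Write the reflection t as u s_i u^-1 with u as short as possible.  Then the
cocycle of u vanishes at t, for otherwise a deletion in a reduced word of u
would spell t u = u s_i, a shorter choice of u; so the cocycle of t takes the
value u(alpha_i) at t. *)
Lemma root_cocycle_reflection t : is_reflection t -> root_cocycle t t != 0.
Proof.
case/existsP=> u /existsP[i /eqP ->].
elim/ltn_ind: {u}(len u) {-2}u (erefl (len u)) => k IHk u ku.
set t' := (u * gen i * u^-1)%g.
have tu : (t' * u = u * gen i)%g by rewrite /t' mulgKV.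
have [u0|] := eqVneq (root_cocycle u t') 0; last first.
  rewrite -[in root_cocycle u](wprod_red_expr u) => /root_cocycle_neq0[d d_in].
  rewrite wprod_red_expr tu => dE.
  have -> : t' = (wprod d.2 * gen i * (wprod d.2)^-1)%g.
    by rewrite dE -(mulgA u) gen_sq mulg1 invMg Defs.genV mulgA.
  apply: (IHk (len (wprod d.2))) => //.
  by rewrite -ku -(size_red_expr u) -(size_deletions d_in) ltnS len_wprod.
have -> : root_cocycle t' =
    root_cocycle u + twist u (simple_delta i) - twist t' (root_cocycle u).
  rewrite {1}/t' !root_cocycleM root_cocycle_gen root_cocycleV.
  by rewrite twistN -twistM.
rewrite !ffunE !conjgE (mulKg t') u0 geom0 subr0 add0r.
rewrite {1}/t' -!mulgA mulKg mulVg mulg1 eqxx.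
apply/eqP => /(congr1 (geom u^-1%g)); rewrite geomK geom0.
by apply/eqP/simple_neq0.
Qed.

(** Let w be the element spelled by a.  If no deletion in a spelled t w, the
cocycle of w would vanish at t.  Since the cocycle of t does not, that of t w
would be nonzero at t, and a deletion in a reduced word of t w would spell w,
which is longer than t w. *)
Lemma strong_exchange a t : is_reflection t ->
  (len (t * wprod a)%g < len (wprod a))%N ->
  exists2 d, d \in deletions a & wprod d.2 = (t * wprod a)%g.
Proof.
move=> refl_t lt_ta; apply: root_cocycle_neq0; apply/eqP=> a0.
have [] := @root_cocycle_neq0 (red_expr (t * wprod a)%g) t.
  rewrite wprod_red_expr root_cocycleM !ffunE conjgE mulKg a0 geom0 addr0.
  exact: root_cocycle_reflection.
move=> d d_in; rewrite wprod_red_expr mulgA.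
rewrite reflection_sq // mul1g => dE.
have := len_wprod d.2; rewrite dE leqNgt => /negP[].
by rewrite (size_deletions d_in) size_red_expr ltnW.
Qed.

End RootCocycle.

(** * The lifting property of the Bruhat order *)

Section Bruhat.
Variables (R : realType) (W : coxeterSystem).
Implicit Types (u v w x y t : W) (a c : seq 'I_(rank W)) (i j : 'I_(rank W)).

Lemma is_reflection_gen i : is_reflection (gen i : W).
Proof.
apply/existsP; exists 1%g; apply/existsP; exists i.
by rewrite mul1g invg1 mulg1.
Qed.

Lemma is_reflectionJ t u : is_reflection t -> is_reflection (u * t * u^-1)%g.
Proof.
case/existsP=> v /existsP[i /eqP ->]; apply/existsP; exists (u * v)%g.
by apply/existsP; exists i; rewrite invMg !mulgA.
Qed.

Lemma bruhat_le_ascent i w : ~~ descent i w -> bruhat_le w (gen i * w)%g.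
Proof.
move=> asc; apply: connect1; apply/existsP; exists (gen i).
by rewrite is_reflection_gen eqxx (ascent_len asc) /=.
Qed.

Lemma bruhat_lt_len x y : bruhat_lt x y -> (len x < len y)%N.
Proof.
case/andP=> neq_xy /connectP[p]; case: p => [_ e|z p /= /andP[xz zp] ->].
  by rewrite e eqxx in neq_xy.
elim: p x z xz {neq_xy} zp => [|z' p IHp] x z /= /existsP[t /and3P[_ _ lt_xz]] //.
by case/andP=> /IHp{}IHp /IHp; apply: ltn_trans.
Qed.

(** With y = t x, the reflection s t s carries s x to s y, so only the case
len (s y) < len (s x) is not immediate.  By parity it forces s x > x, s y < y
and len y = len x + 1.  Strong exchange in a reduced word of y that begins with
s obtains x by deleting a letter; this must be the first one, since otherwise
s x would be shorter than x.  Hence s x = y. *)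
Lemma bruhat_lift_step i x y : bruhat_step x y ->
  bruhat_le (gen i * x)%g y \/ bruhat_le (gen i * x)%g (gen i * y)%g.
Proof.
case/existsP=> t /and3P[refl_t /eqP y_tx lt_xy].
have [lt_sxsy|] := ltnP (len (gen i * x)%g) (len (gen i * y)%g).
  right; apply: connect1; apply/existsP; exists (gen i * t * (gen i)^-1)%g.
  rewrite is_reflectionJ // lt_sxsy y_tx andbT /=.
  by rewrite Defs.genV -!mulgA gen_mulK.
move=> le_sysx; left.
have odd_xy : odd (len y) = ~~ odd (len x).
  by rewrite y_tx odd_lenM (odd_len_reflection refl_t).
have asc_x : ~~ descent i x.
  apply/negP=> dx; have := descent_len dx.
  have [dy|/ascent_len] := boolP (descent i y); last by lia.
  by have := descent_len dy; lia.
have desc_y : descent i y.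
  by apply: contraT => /ascent_len; have := ascent_len asc_x; lia.
have len_y : len y = (len x).+1.
  by have := descent_len desc_y; have := ascent_len asc_x; lia.
pose a := i :: red_expr (gen i * y)%g.
have a_y : wprod a = y by rewrite wprod_cons wprod_red_expr gen_mulK.
have tyx : (t * y)%g = x by rewrite y_tx mulgA reflection_sq ?mul1g.
have := @strong_exchange R W a t refl_t; rewrite a_y tyx => /(_ lt_xy)[d].
rewrite inE => /orP[/eqP -> /=|].
  by rewrite wprod_red_expr => <-; rewrite gen_mulK; apply: connect0.
case/mapP=> e /size_deletions; rewrite size_red_expr => e_size -> /=.
rewrite wprod_cons => x_e; have := len_wprod e.2.
have := ascent_len asc_x; rewrite -{1}x_e gen_mulK => ->.
have := descent_len desc_y; rewrite -e_size len_y => -[->].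
by rewrite ltnNge leqnSn.
Qed.

Lemma bruhat_lift i x y : bruhat_le x y -> ~~ descent i y ->
  bruhat_le (gen i * x)%g (gen i * y)%g.
Proof.
move=> le_xy asc_y.
suff [le_sxy|//] :
    bruhat_le (gen i * x)%g y \/ bruhat_le (gen i * x)%g (gen i * y)%g.
  exact: connect_trans le_sxy (bruhat_le_ascent asc_y).
case/connectP: le_xy => p; elim: p x => [|z p IHp] x /=.
  by move=> _ ->; right; apply: connect0.
case/andP=> xz zp yE.
have le_zy : bruhat_le z y by apply/connectP; exists p.
have [le_sxz|le_sxsz] := bruhat_lift_step i xz.
  by left; apply: connect_trans le_sxz le_zy.
by have [le|le] := IHp z zp yE; [left|right]; apply: connect_trans le_sxsz le.
Qed.

End Bruhat.

(** * Operators on the coinvariant algebra *)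

Section CoinvOperators.
Variables (R : realType) (W : coxeterSystem).
Local Notation n := (rank W).
Local Notation h := 'rV[R]_n.
Local Notation Sh := {mpoly R[i][n]}.
Local Notation Q := (coinv R W).
Implicit Types (x y l : h) (u v w t : W) (a c : seq 'I_n) (i j : 'I_n).
Implicit Types (f g : Sh) (z : Q).

Definition proj f : Q := (\pi_Q f)%qT.

Lemma proj_zmod_morphism : zmod_morphism proj.
Proof.
move=> f g; exact: (etrans (Quotient.pi_add _ f (- g))
  (congr1 (Quotient.add _) (Quotient.pi_opp _ g))).
Qed.

Lemma proj_monoid_morphism : monoid_morphism proj.
Proof.
split; last exact: Quotient.pi_mul.
(* The unit of the quotient is the locked class of 1. *)
exact: (lock _).
Qed.

HB.instance Definition _ :=
  GRing.isZmodMorphism.Build Sh Q proj proj_zmod_morphism.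
HB.instance Definition _ :=
  GRing.isMonoidMorphism.Build Sh Q proj proj_monoid_morphism.

Lemma projP (P : Q -> Prop) : (forall f, P (proj f)) -> forall z, P z.
Proof. by move=> Pf z; rewrite -[z]reprK; apply: Pf. Qed.

Lemma cact_proj u f : cact u (proj f) = proj (pact u f).
Proof. exact: cactE. Qed.

Lemma cdd_proj i f : cdd (simple i) (proj f) = proj (ddiff (simple i) f).
Proof. exact/cddE/is_root_simple. Qed.

Lemma pact_root_refl u i f :
  pact (root_refl (geom u (simple i) : h)) f = pact (u * gen i * u^-1)%g f.
Proof.
apply: eq_geom_pact => x.
by rewrite geom_root_refl ?is_root_geom // geom_conj.
Qed.

Lemma pact_root_refl_simple i f :
  pact (root_refl (simple i : h)) f = pact (gen i) f.
Proof.
by rewrite -[simple i](geom1 (W := W)) pact_root_refl mul1g invg1 mulg1.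
Qed.

Lemma ddiff_simpleE i f :
  lform (simple i : h) * ddiff (simple i) f = f - pact (gen i) f.
Proof. by rewrite ddiffE ?is_root_simple // pact_root_refl_simple. Qed.

Lemma ddiff_simple_unique i f g :
  lform (simple i : h) * g = f - pact (gen i) f -> ddiff (simple i) f = g.
Proof.
move=> eg; apply: ddiff_unique; first exact: is_root_simple.
by rewrite pact_root_refl_simple.
Qed.

Lemma pact_lform_simple i :
  pact (gen i) (lform (simple i : h)) = - lform (simple i).
Proof.
rewrite pact_lform geom_gen simple_refl_simple -scaleN1r lformZ.
by rewrite rmorphN rmorph1 scaleN1r.
Qed.

Lemma ddiff_pact_conj u i f :
  ddiff (geom u (simple i : h)) (pact u f) = pact u (ddiff (simple i) f).
Proof.
apply: ddiff_unique; first exact: is_root_geom.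
rewrite pact_root_refl -pact_lform -pactMr ddiff_simpleE pactB.
by rewrite -!pactM mulgKV.
Qed.

Lemma cactM u v z : cact (u * v)%g z = cact u (cact v z).
Proof. by elim/projP: z => f; rewrite !cact_proj pactM. Qed.

Lemma cact1 z : cact 1%g z = z.
Proof. by elim/projP: z => f; rewrite cact_proj pact1. Qed.

Lemma cact_zmod_morphism u : zmod_morphism (cact u : Q -> Q).
Proof.
by elim/projP=> f; elim/projP=> g; rewrite -raddfB !cact_proj pactB raddfB.
Qed.
HB.instance Definition _ u :=
  GRing.isZmodMorphism.Build Q Q (cact u) (@cact_zmod_morphism u).

Lemma cdd_zmod_morphism i : zmod_morphism (cdd (simple i) : Q -> Q).
Proof.
elim/projP=> f; elim/projP=> g; rewrite -raddfB !cdd_proj.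
by rewrite ddiffB ?is_root_simple // raddfB.
Qed.
HB.instance Definition _ i :=
  GRing.isZmodMorphism.Build Q Q (cdd (simple i)) (@cdd_zmod_morphism i).

Lemma cact_mulf u f z : cact u (proj f * z) = proj (pact u f) * cact u z.
Proof. by elim/projP: z => g; rewrite -rmorphM !cact_proj pactMr rmorphM. Qed.

Lemma cact_one u : cact u (1 : Q) = 1.
Proof. by rewrite -(rmorph1 proj) cact_proj -mpolyC1 pactC. Qed.

Lemma cdd_one i : cdd (simple i) (1 : Q) = 0.
Proof.
rewrite -(rmorph1 proj) cdd_proj -(rmorph0 proj); congr proj.
by apply: ddiff_simple_unique; rewrite -mpolyC1 pactC mulr0 subrr.
Qed.

Lemma cdd_mulf i f z : cdd (simple i) (proj f * z) =
  proj (ddiff (simple i) f) * z + proj (pact (gen i) f) * cdd (simple i) z.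
Proof.
elim/projP: z => g; rewrite -rmorphM !cdd_proj -!rmorphM -rmorphD.
congr proj; apply: ddiff_simple_unique.
rewrite mulrDr mulrA ddiff_simpleE mulrCA ddiff_simpleE pactMr.
by rewrite mulrBl mulrBr addrA subrK.
Qed.

Lemma ddiffC i (k : R[i]) : ddiff (simple i : h) k%:MP = 0.
Proof. by apply: ddiff_simple_unique; rewrite pactC subrr mulr0. Qed.

Lemma ddiff_lform i l :
  ddiff (simple i : h) (lform l) = ((2 * Defs.formB l (simple i))%:C%C)%:MP.
Proof.
apply: ddiff_simple_unique.
rewrite pact_lform geom_gen /simple_refl -scaleNr lformD lformZ opprD addNKr.
by rewrite rmorphN scaleNr opprK mulrC mul_mpolyC.
Qed.

Lemma cdd_cdd i z : cdd (simple i) (cdd (simple i) z) = 0.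
Proof.
elim/projP: z => f; rewrite !cdd_proj -(rmorph0 proj); congr proj.
apply: ddiff_simple_unique; rewrite mulr0.
apply: (mulfI (lform_root_neq0 (is_root_simple R i))).
rewrite mulr0 mulrBr ddiff_simpleE.
rewrite -[X in X * pact _ _]opprK -pact_lform_simple mulNr -pactMr ddiff_simpleE.
by rewrite pactB -pactM gen_sq pact1 !opprB addrA subrK subrr.
Qed.

Lemma cact_cdd i z : cact (gen i) (cdd (simple i) z) = cdd (simple i) z.
Proof.
elim/projP: z => f; rewrite !cdd_proj cact_proj; congr proj.
apply: (mulfI (lform_root_neq0 (is_root_simple R i))).
rewrite -[X in X * pact _ _]opprK -pact_lform_simple mulNr -pactMr ddiff_simpleE.
by rewrite pactB -pactM gen_sq pact1 opprB.
Qed.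

Lemma cdd_cact i z : cdd (simple i) (cact (gen i) z) = - cdd (simple i) z.
Proof.
elim/projP: z => f; rewrite cact_proj !cdd_proj -rmorphN; congr proj.
apply: ddiff_simple_unique.
by rewrite mulrN ddiff_simpleE -pactM gen_sq pact1 opprB.
Qed.

Lemma cdd_conj u i z :
  cdd (geom u (simple i)) (cact u z) = cact u (cdd (simple i) z).
Proof.
elim/projP: z => f; rewrite cdd_proj !cact_proj -ddiff_pact_conj.
exact/cddE/is_root_geom.
Qed.

End CoinvOperators.

(** * Skew operators of words *)

Section SkewWords.
Variables (R : realType) (W : coxeterSystem).
Local Notation n := (rank W).
Local Notation h := 'rV[R]_n.
Local Notation Sh := {mpoly R[i][n]}.
Local Notation Q := (coinv R W).
Implicit Types (x y l : h) (u v w t : W) (a c e : seq 'I_n) (i j : 'I_n).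
Implicit Types (f g : Sh) (z : Q).

Fixpoint word_skew a v z : Q :=
  if a is i :: c then
    cdd (simple i) (word_skew c v z) +
    (if descent i v then cact (gen i) (word_skew c (gen i * v)%g z) else 0)
  else if v == 1%g then z else 0.

Lemma word_skew_zmod_morphism a v : zmod_morphism (word_skew a v).
Proof.
elim: a v => [|i a IHa] v z1 z2 /=; first by case: eqP; rewrite ?subr0.
rewrite !IHa !raddfB opprD addrACA; congr (_ + _).
by case: ifP; rewrite ?subr0.
Qed.

Lemma word_skew_scalar a v (k : R[i]) z :
  word_skew a v (proj (k%:MP : Sh) * z) = proj (k%:MP : Sh) * word_skew a v z.
Proof.
elim: a v => [|i a IHa] v /=; first by case: eqP; rewrite ?mulr0.
rewrite !IHa cdd_mulf ddiffC raddf0 mul0r add0r pactC mulrDr; congr (_ + _).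
by case: ifP; rewrite ?mulr0 // cact_mulf pactC.
Qed.

(** The value on the linear form l of the divided difference at a simple root x. *)
Definition pairing l x : Q := proj ((2 * Defs.formB l x)%:C%C)%:MP.

Lemma pairingD l x y : pairing l (x + y) = pairing l x + pairing l y.
Proof. by rewrite /pairing formBDr mulrDr rmorphD mpolyCD raddfD. Qed.

Lemma pairing0 l : pairing l 0 = 0.
Proof. by apply: (addrI (pairing l 0)); rewrite -pairingD !addr0. Qed.

Lemma pairing_gen i l x : pairing (geom (gen i) l) x = pairing l (simple_refl i x).
Proof.
by rewrite /pairing -[in RHS](formB_geom (gen i)) -geom_gen -geomM gen_sq geom1.
Qed.

Lemma cdd_pairing i l x z :
  cdd (simple i) (pairing l x * z) = pairing l x * cdd (simple i) z.
Proof. by rewrite cdd_mulf ddiffC raddf0 mul0r add0r pactC. Qed.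

Lemma cact_pairing u l x z : cact u (pairing l x * z) = pairing l x * cact u z.
Proof. by rewrite cact_mulf pactC. Qed.

(** A linear form crosses a simple reflection, or a divided difference, by being
reflected; in the second case an extra scalar term arises, in which the divided
difference is gone.  Deleting a letter that acts as a divided difference
leaves the chosen subword unchanged, so the extra terms add up to the operators
of the words with one letter deleted. *)
Lemma word_skew_lform a v l z :
  word_skew a v (proj (lform (geom (wprod a)^-1%g l)) * z) =
  proj (lform l) * word_skew a v z -
  \sum_(d <- deletions R a) pairing l d.1 * word_skew d.2 v z.
Proof.
elim: a v l => [|i a IHa] v l /=.
  by rewrite big_nil subr0 wprod_nil invg1 geom1; case: eqP; rewrite ?mulr0.
rewrite wprod_cons invMg Defs.genV geomM !IHa big_cons big_map /=.
rewrite !raddfB /= cdd_mulf cact_mulf pact_lform -geomM gen_sq geom1.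
rewrite ddiff_lform -/(pairing _ _) pairing_gen.
have -> : pairing l (simple_refl i (simple i)) = - pairing l (simple i).
  rewrite simple_refl_simple; apply/eqP.
  by rewrite -addr_eq0 -pairingD addNr pairing0.
have cddS : cdd (simple i) (\sum_(d <- deletions R a)
      pairing (geom (gen i) l) d.1 * word_skew d.2 v z) =
    \sum_(d <- deletions R a)
      pairing l (simple_refl i d.1) * cdd (simple i) (word_skew d.2 v z).
  rewrite raddf_sum; apply: eq_bigr => d _ /=.
  by rewrite cdd_pairing pairing_gen.
have cactS u : cact (gen i) (\sum_(d <- deletions R a)
      pairing (geom (gen i) l) d.1 * word_skew d.2 u z) =
    \sum_(d <- deletions R a)
      pairing l (simple_refl i d.1) * cact (gen i) (word_skew d.2 u z).
  rewrite raddf_sum; apply: eq_bigr => d _ /=.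
  by rewrite cact_pairing pairing_gen.
rewrite mulNr cddS cactS; case: ifP => _.
  by under [in RHS]eq_bigr do rewrite mulrDr; rewrite big_split /=; ring.
by under [in RHS]eq_bigr do rewrite addr0; ring.
Qed.

(** Such an operator D is w followed by multiplication by D(1), because the
linear forms generate the algebra. *)
Lemma twisted_scalar_eq0 (D : Q -> Q) w :
  zmod_morphism D ->
  (forall (k : R[i]) z, D (proj (k%:MP : Sh) * z) = proj (k%:MP : Sh) * D z) ->
  (forall l z, D (proj (lform (geom w^-1%g l)) * z) = proj (lform l) * D z) ->
  D 1 = 0 -> forall z, D z = 0.
Proof.
move=> DB DC Dl D1.
have D0 : D 0 = 0 by rewrite -[X in D X](subrr 0) DB subrr.
have DD z1 z2 : D (z1 + z2) = D z1 + D z2.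
  by rewrite -{1}[z2]opprK DB -{1}[- z2]sub0r DB D0 sub0r opprK.
have Df f z : D (proj f * z) = proj (pact w f) * D z.
  elim/poly_ind_alg: f z => [k|i|f g IHf IHg|f g IHf IHg] z.
  - by rewrite DC pactC.
  - by rewrite -(lform_simple R) -{1}(geomK w (simple i)) Dl pact_lform.
  - by rewrite raddfD /= mulrDl DD IHf IHg pactD raddfD /= mulrDl.
  - by rewrite rmorphM -mulrA IHf IHg pactMr rmorphM mulrA.
by elim/projP=> f; rewrite -[proj f]mulr1 Df D1 mulr0.
Qed.

Lemma word_skew_one a v : word_skew a v 1 = (reduced_expr a v)%:R.
Proof.
elim: a v => [|i a IHa] v /=; first by rewrite reduced_expr1; case: eqP.
rewrite !IHa reduced_expr_cons; have cddn m : cdd (simple i) (m%:R : Q) = 0.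
  by rewrite raddfMn /= cdd_one mul0rn.
by rewrite cddn add0r; case: ifP => //= _; rewrite raddfMn /= cact_one.
Qed.

(** The right-hand side depends only on the element spelled by a. *)
Lemma sum_deletions a l (F : W -> Q) :
  \sum_(d <- deletions R a) pairing l d.1 * F (wprod d.2) =
  \sum_t pairing l (root_cocycle R (wprod a) t) * F (t * wprod a)%g.
Proof.
under [RHS]eq_bigr => t _.
  rewrite -word_cocycleE word_cocycle_deletions.
  rewrite (big_morph (pairing l) (pairingD l) (pairing0 l)).
  rewrite mulr_suml big_mkcond; over.
rewrite exchange_big /=; apply: eq_bigr => d _.
rewrite (bigD1 (wprod d.2 * (wprod a)^-1)%g) //= mulgKV eqxx big1 ?addr0 //.
move=> t neq_t; case: ifP => // /eqP dE.
by rewrite dE mulgK eqxx in neq_t.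
Qed.

Lemma word_skew_eq a c v (F : W -> Q -> Q) :
  wprod a = wprod c -> size a = size c ->
  (forall d z, d \in deletions R a ++ deletions R c ->
     word_skew d.2 v z = F (wprod d.2) z) ->
  forall z, word_skew a v z = word_skew c v z.
Proof.
move=> ac_w ac_size skewF z; apply/eqP; rewrite -subr_eq0; apply/eqP.
have sumF b l z' : {subset deletions R b <= deletions R a ++ deletions R c} ->
    \sum_(d <- deletions R b) pairing l d.1 * word_skew d.2 v z' =
    \sum_t pairing l (root_cocycle R (wprod b) t) * F (t * wprod b)%g z'.
  move=> sub_b; rewrite -(sum_deletions b l (F^~ z')) !big_seq.
  by apply: eq_bigr => d /sub_b d_in; rewrite skewF.
move: z; apply: (@twisted_scalar_eq0 _ (wprod a)) => [z1 z2|k z|l z|].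
- by rewrite !word_skew_zmod_morphism; ring.
- by rewrite !word_skew_scalar mulrBr.
- rewrite word_skew_lform ac_w word_skew_lform !sumF ?ac_w.
  + by ring.
  + by move=> d d_in; rewrite mem_cat d_in orbT.
  + by move=> d d_in; rewrite mem_cat d_in.
by rewrite !word_skew_one /reduced_expr ac_w ac_size subrr.
Qed.

(** Induction on the size k of a.  If a is reduced, so is [red_expr (wprod a)],
and the words with one letter deleted have size k - 1, so that their operators
are known to depend only on the element they spell.  If a is not reduced, the
operator of its tail vanishes, or the tail is reduced and may be replaced by a
word that begins with the first letter i of a; the two letters i then
annihilate each other. *)
Lemma word_skew_reduced a v z :
  word_skew a v z = if reduced a then word_skew (red_expr (wprod a)) v z else 0.
Proof.
elim/ltn_ind: {a}(size a) {-2}a (erefl (size a)) v z => k IHk a ak v z.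
case: ifP => red_a.
  have size_a := reduced_size red_a.
  (* A deletion has size k - 1, so the test in F decides whether it is
     reduced. *)
  pose F u z := if k == (len u).+1 then word_skew (red_expr u) v z else 0.
  apply: (@word_skew_eq _ _ _ F); rewrite ?wprod_red_expr ?size_red_expr //.
  move=> d z'; rewrite mem_cat => d_in.
  have size_d : (size d.2).+1 = k.
    by case/orP: d_in => /size_deletions ->; rewrite // size_red_expr -size_a.
  by rewrite (IHk (size d.2)) ?size_d // reducedE /F -size_d eqSS.
case: a ak red_a => [|i a] /= ak.
  by rewrite /reduced reduced_expr1 wprod_nil eqxx.
rewrite reduced_cons; have [red_a|nred_a _] := boolP (reduced a); last first.
  have a0 v' : word_skew a v' z = 0.
    by rewrite (IHk (size a)) -?ak // (negPf nred_a).
  rewrite !a0 (raddf0 (cdd (simple i))) (raddf0 (cact (gen i))).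
  by rewrite if_same addr0.
rewrite andbT => /negbFE desc.
have [wq red_q] := reduced_exprP _ _ (red_exprP (gen i * wprod a)%g).
set q := red_expr _ in wq red_q.
have wiq : wprod (i :: q) = wprod a by rewrite wprod_cons wq gen_mulK.
have size_iq : size (i :: q) = size a.
  by rewrite /= size_red_expr -(descent_len desc) reduced_size.
have red_iq : reduced (i :: q) by rewrite reducedE size_iq wiq -reducedE.
have aE v' z' : word_skew a v' z' = word_skew (i :: q) v' z'.
  rewrite (IHk (size a)) -?ak // red_a.
  by rewrite [RHS](IHk (size a)) -?ak // red_iq wiq.
rewrite !aE /= raddfD /= cdd_cdd add0r descentC.
case: (descent i v) => /=; rewrite ?raddf0 ?addr0 //.
by rewrite cdd_cact cact_cdd addNr.
Qed.

Lemma word_skew_bruhat a v z :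
  reduced a -> word_skew a v z != 0 -> bruhat_le v (wprod a).
Proof.
elim: a v => [|i a IHa] v.
  rewrite wprod_nil /= => _; have [->|] := eqVneq v 1%g; last by rewrite eqxx.
  by move=> _; apply: connect0.
rewrite reduced_cons wprod_cons => /andP[asc red_a] /=.
have [av0|/(IHa v red_a) le_va _] := eqVneq (word_skew a v z) 0; last first.
  exact: connect_trans le_va (bruhat_le_ascent asc).
rewrite av0 raddf0 add0r; case: ifP => desc_v; rewrite ?eqxx // => siv0.
have /(IHa _ red_a) le_sva : word_skew a (gen i * v)%g z != 0.
  by apply: contra siv0 => /eqP ->; rewrite raddf0.
by rewrite -[v](gen_mulK i); apply: (bruhat_lift R).
Qed.

End SkewWords.

(** * From subwords to the recursion *)

Section SubsetsOfOrdinals.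
Variable m : nat.
Implicit Types (b : bool) (J : {set 'I_m}).

Definition set_cons b J : {set 'I_m.+1} :=
  [set j | if unlift ord0 j is Some k then k \in J else b].

Lemma in_set_cons0 b J : (ord0 \in set_cons b J) = b.
Proof. by rewrite inE unlift_none. Qed.

Lemma in_set_cons_lift b J k : (lift ord0 k \in set_cons b J) = (k \in J).
Proof. by rewrite inE liftK. Qed.

Lemma sum_set_cons (V : nmodType) (F : {set 'I_m.+1} -> V) :
  \sum_A F A = \sum_J F (set_cons false J) + \sum_J F (set_cons true J).
Proof.
rewrite addrC -(big_bool _ (fun b => \sum_J F (set_cons b J))) pair_big /=.
rewrite (reindex (fun p => set_cons p.1 p.2)) //=.
pose uncons (A : {set 'I_m.+1}) := (ord0 \in A, [set k | lift ord0 k \in A]).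
exists uncons => [[b J] _|A _].
  rewrite /uncons /= in_set_cons0; congr pair; apply/setP=> k.
  by rewrite inE in_set_cons_lift.
apply/setP=> j /=; case: (unliftP ord0 j) => [k|] ->.
  by rewrite in_set_cons_lift inE.
by rewrite in_set_cons0.
Qed.

Lemma enum_set_cons b J :
  enum (set_cons b J) = nseq b ord0 ++ [seq lift ord0 k | k <- enum J].
Proof.
rewrite {1}/enum_mem -enumT enum_ordSl /= in_set_cons0 filter_map.
have -> : [seq k <- enum 'I_m | preim (lift ord0) (mem (set_cons b J)) k] =
    enum J.
  rewrite [RHS]/enum_mem -enumT; apply: eq_filter => k.
  by rewrite /= in_set_cons_lift.
by case: b.
Qed.

End SubsetsOfOrdinals.

Section SkewDdiff.
Variables (R : realType) (W : coxeterSystem).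
Local Notation n := (rank W).
Implicit Types (v w : W) (a : seq 'I_n) (i : 'I_n) (z : coinv R W).

Lemma subword_cons i a b (J : {set 'I_(size a)}) :
  @subword W (i :: a) (set_cons b J) = nseq b i ++ subword J.
Proof.
rewrite /subword enum_set_cons map_cat -map_comp; congr (_ ++ _).
  by case: b => //=; rewrite (tnth_nth i).
by apply: eq_map => k; rewrite /= !(tnth_nth i).
Qed.

Lemma skew_term_cons i a b (J : {set 'I_(size a)}) z :
  @skew_term R W (i :: a) (set_cons b J) z =
  (if b then cact (gen i) else cdd (simple i)) (skew_term J z).
Proof.
rewrite /skew_term big_ord_recl /= in_set_cons0 (tnth_nth i) /=.
congr ((if b then _ else _) _); congr (_ z); apply: eq_bigr => k _.
by rewrite in_set_cons_lift !(tnth_nth i).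
Qed.

(** The subsets J split according to whether they contain the first position;
a word i :: c is reduced for v exactly when s_i v < v and c is reduced for
s_i v. *)
Lemma sum_skew_term a v z :
  \sum_(J : {set 'I_(size a)} | reduced_expr (subword J) v) skew_term J z =
  word_skew a v z.
Proof.
elim: a v => [|i a IHa] v.
  have sub0 (J : {set 'I_0}) : @subword W [::] J = [::].
    by rewrite /subword; case: (enum J) => // -[].
  under eq_bigl => J do rewrite sub0 reduced_expr1.
  under eq_bigr => J _ do rewrite /skew_term big_ord0 /=.
  rewrite /=; case: eqP => _; last by rewrite big_pred0.
  by rewrite (big_pred1 finset.set0) // => J; apply/esym/eqP/setP; case.
rewrite big_mkcond sum_set_cons /=; congr (_ + _).
  rewrite -IHa raddf_sum [RHS]big_mkcond /=; apply: eq_bigr => J _.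
  by rewrite subword_cons skew_term_cons.
under eq_bigr => J _ do rewrite subword_cons skew_term_cons /= reduced_expr_cons.
case: ifP => desc; last by rewrite big1.
by rewrite -IHa raddf_sum [RHS]big_mkcond.
Qed.

(** Both the choice of a reduced word and the case distinction on the Bruhat
order disappear. *)
Lemma skew_ddiffE w v a z : reduced_expr a w ->
  skew_ddiff w v z = cact v^-1%g (word_skew a v z).
Proof.
move=> /reduced_exprP[aw red_a]; rewrite word_skew_reduced red_a aw.
rewrite /skew_ddiff sum_skew_term; case: ifP => // not_le.
have [->|] := eqVneq (word_skew (red_expr w) v z) 0; first by rewrite raddf0.
have [_ red_w] := reduced_exprP _ _ (red_exprP w).
by move/(word_skew_bruhat red_w); rewrite wprod_red_expr not_le.
Qed.

End SkewDdiff.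

Theorem corollary1p11 (R : realType) (W : coxeterSystem) (v w : W)
    (b : 'I_(rank W)) :
  bruhat_le v w ->
  bruhat_lt v (gen b * v)%g ->
  let v' : W := (gen b * v)%g in
  let w' : W := (gen b * w)%g in
  let alpha : 'rV[R]_(rank W) := geom v^-1%g (simple b) in
  (bruhat_lt w' w ->
     forall z : coinv R W,
       skew_ddiff w v z = cdd alpha (skew_ddiff w v' z)) /\
  (bruhat_lt w w' ->
     forall z : coinv R W,
       skew_ddiff w v z = cdd alpha (skew_ddiff w v' z) + skew_ddiff w' v' z).
Proof.
move=> _ /bruhat_lt_len lt_v v' w' alpha.
have desc_v' : descent b v' by rewrite /descent gen_mulK.
have asc_v : descent b v = false by apply/negbTE; rewrite -descentC.
have v'V : v'^-1%g = (v^-1 * gen b)%g by rewrite invMg Defs.genV.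
have cdd_alpha y : cdd alpha (cact v'^-1%g y) = - cact v^-1%g (cdd (simple b) y).
  by rewrite v'V cactM cdd_conj cdd_cact raddfN.
split=> [/bruhat_lt_len lt_w z|/bruhat_lt_len lt_w z].
  have red_w : reduced_expr (b :: red_expr w') w.
    by rewrite reduced_expr_cons /descent lt_w red_exprP.
  rewrite !(skew_ddiffE _ _ red_w) cdd_alpha /= desc_v' asc_v gen_mulK addr0.
  by rewrite raddfD /= cdd_cdd add0r cdd_cact raddfN opprK.
have red_w' : reduced_expr (b :: red_expr w) w'.
  by rewrite reduced_expr_cons /descent gen_mulK lt_w red_exprP.
rewrite !(skew_ddiffE _ _ (red_exprP w)) (skew_ddiffE _ _ red_w') cdd_alpha.
rewrite /= desc_v' gen_mulK v'V cactM [cact (gen b) _]raddfD /= cact_cdd.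
by rewrite -[cact (gen b) (cact _ _)]cactM gen_sq cact1 raddfD /= addKr.
Qed.
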